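(* Let $X$ be a compact metric space and $f:X\to X$ a continuous map. If $(X,f)$ is chain transitive, then $(\mathcal{M}(X),\hat f)$ is chain mixing, chain weakly mixing of all orders, chain exact, and chain transitive.
   Context: For a compact metric space $(X,d)$, $\mathcal{M}(X)$ is the space of all Borel probability measures on $X$ with the Prohorov metric $\mathcal{P}_d(\mu,\nu)=\inf\{\epsilon>0:\mu(A)\le\nu(A^\epsilon)+\epsilon \text{ and } \nu(A)\le\mu(A^\epsilon)+\epsilon \text{ for all Borel } A\subset X\}$, where $A^\epsilon=\{x\in X: d(x,A)<\epsilon\}$; its topology is the weak$^*$-topology and $\mathcal{M}(X)$ is a compact metric space. The induced continuous map is $\hat f(\mu)(A)=\mu(f^{-1}(A))$. For a continuous self-map $f$ of a compact metric space $(X,d)$ and $\delta>0$, a $\delta$-chain from $x$ to $y$ with length $k\ge1$ is a finite sequence $x=x_0,x_1,\dots,x_k=y$ in $X$ with $d(f(x_n),x_{n+1})<\delta$ for $0\le n\le k-1$. $(X,f)$ is chain transitive if for any $x,y\in X$ and $\varepsilon>0$ there is an $\varepsilon$-chain from $x$ to $y$. It is chain mixing if for any $\varepsilon>0$ and any $x,y\in X$ there is $N\ge1$ such that for every $k\ge N$ there is an $\varepsilon$-chain from $x$ to $y$ with length $k$. It is chain weakly mixing of all orders if for every $n\ge1$ the $n$-fold product system $(X^n,f\times\cdots\times f)$, with metric $d_n(x,y)=\max_{1\le i\le n}d(x_i,y_i)$, is chain transitive. It is chain exact if for any $\varepsilon>0$ and any nonempty open $U\subset X$ there is $N\ge1$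 such that for every $x\in X$ there exist $y\in U$ and an $\varepsilon$-chain from $y$ to $x$ with length $N$. *)

(* Defs.v *)
From HB Require Import structures.
From mathcomp Require Import all_boot all_order all_algebra.
From mathcomp Require Import all_classical all_reals all_analysis.

Set Implicit Arguments.
Unset Strict Implicit.
Unset Printing Implicit Defensive.

Import Order.TTheory GRing.Theory Num.Theory.

Local Open Scope classical_set_scope.
Local Open Scope ring_scope.

(* Measurable types are pointed in the library, so the underlying metric space
   is taken with a base point; nothing below depends on its choice. *)
#[short(type="pmetricType")]
HB.structure Definition PointedMetric (R : numDomainType) :=
  {T of Pointed T & Metric R T}.

(* Chain properties of a map [f] on a carrier [T] with distance [d]. The
   distance is an argument, so that they apply alike to a metric space, to its
   finite powers with the maximum distance, and to the space of probability
   measures with the Prohorov distance. *)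
Section chains.
Context {R : realType} {T : Type}.
Variables (d : T -> T -> R) (f : T -> T).

(* The chain is x :: s, hence its length is the size of s. *)
Definition is_chain (delta : R) (k : nat) (x y : T) : Prop :=
  (0 < k)%N /\
  exists s : seq T,
    [/\ size s = k, path (fun u v => d (f u) v < delta) x s & last x s = y].

Definition chain_transitive : Prop :=
  forall (x y : T) (e : R), 0 < e -> exists k : nat, is_chain e k x y.

Definition chain_mixing : Prop :=
  forall e : R, 0 < e -> forall x y : T,
    exists2 N : nat, (0 < N)%N &
      forall k : nat, (N <= k)%N -> is_chain e k x y.

Definition dist_open (U : set T) : Prop :=
  forall x, U x -> exists2 r : R, 0 < r & forall y, d x y < r -> U y.

Definition chain_exact : Prop :=
  forall (e : R) (U : set T), 0 < e -> dist_open U -> U !=set0 ->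
    exists2 N : nat, (0 < N)%N &
      forall x : T, exists2 y : T, U y & is_chain e N y x.

End chains.

Section powers.
Context {R : realType} {T : Type}.

Definition power_dist (n : nat) (d : T -> T -> R) (x y : 'I_n -> T) : R :=
  \big[Num.max/0]_(i < n) d (x i) (y i).

Definition power_map (n : nat) (f : T -> T) (x : 'I_n -> T) : 'I_n -> T :=
  fun i => f (x i).

Definition chain_weakly_mixing_all_orders (d : T -> T -> R) (f : T -> T) :
    Prop :=
  forall n : nat, (0 < n)%N ->
    chain_transitive (@power_dist n d) (@power_map n f).

End powers.

Definition borel {R : realType} (X : pmetricType R) :=
  g_sigma_algebraType (@open X).

(* Library measures are functions on all sets, measurable or not; two of them
   that agree on the Borel sets may thus differ as terms. They are then at
   Prohorov distance 0 from each other and from any third measure they are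
   equally distant, so no chain property distinguishes them. *)
Definition borel_prob {R : realType} (X : pmetricType R) : Type :=
  probability (borel X) R.

Section prohorov.
Context {R : realType} {X : pmetricType R}.
Local Open Scope ereal_scope.

(* The infimum over the empty set is +oo, hence [fattening set0 e] is empty. *)
Definition dist_to_set (x : X) (A : set X) : \bar R :=
  ereal_inf [set (mdist x a)%:E | a in A].

Definition fattening (A : set X) (e : R) : set X :=
  [set x | dist_to_set x A < e%:E].

Definition prohorov (mu nu : borel_prob X) : R :=
  inf [set e : R | (0 < e)%R /\
    forall A : set (borel X), measurable A ->
      mu A <= nu (fattening A e) + e%:E /\
      nu A <= mu (fattening A e) + e%:E].

End prohorov.

Section induced_map.
Context {R : realType} {X : pmetricType R}.

Lemma continuous_borel_measurable (f : X -> X) :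
  continuous f -> measurable_fun [set: borel X] (f : borel X -> borel X).
Proof.
move=> /continuousP cf.
apply: (@measurability _ _ (borel X) (borel X) setT f (@open X) erefl).
by move=> _ [U oU <-]; rewrite setTI; apply: sub_sigma_algebra; exact: cf.
Qed.

Definition borel_mfun (f : X -> X) (cf : continuous f) :
    {mfun borel X >-> borel X} :=
  HB.pack (f : borel X -> borel X)
    (isMeasurableFun.Build _ _ _ _ (f : borel X -> borel X)
       (continuous_borel_measurable cf)).

Definition induced_map (f : X -> X) (cf : continuous f) (mu : borel_prob X) :
    borel_prob X :=
  distribution mu (borel_mfun cf).

Lemma induced_mapE (f : X -> X) (cf : continuous f) (mu : borel_prob X)
    (A : set (borel X)) :
  induced_map cf mu A = mu (f @^-1` A).
Proof. by []. Qed.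

End induced_map.

(* Main.v *)
(** Teleporting a fraction [1/k] of the mass of a measure moves it by at most
    [1/k] in the Prohorov distance. Chain transitivity and compactness give a
    Borel map [p] with [d (f (p x)) x < e] for all [x], so that
    [p^(k-j) nu], [j = 0, ..., k], is a pseudo-orbit of the induced map [F]
    ending at [nu]. Then [(1 - j/k) F^j mu + (j/k) p^(k-j) nu] is a
    pseudo-orbit of length [k] from [mu] to [nu] as soon as [1/k <= e], and the
    bound on [k] does not depend on [mu] and [nu]. *)
From HB Require Import structures.
Require Import Defs.
From mathcomp Require Import all_boot all_order all_algebra.
From mathcomp Require Import all_classical all_reals all_analysis.
From mathcomp Require Import lra.

Import Order.TTheory GRing.Theory Num.Theory.

Local Open Scope classical_set_scope.
Local Open Scope ring_scope.

(** * Chain mixing with a length bound uniform in the endpoints *)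

Section uniform_chain_mixing.
Context {R : realType} {T : Type}.
Implicit Types (d : T -> T -> R) (f : T -> T).

(** Points are indexed by all of [nat], with no constraint beyond [k], so that orbits can be given
    by a formula in [j] and combined coordinatewise. *)
Definition pseudo_orbit d f (e : R) (k : nat) (x y : T) (u : nat -> T) : Prop :=
  [/\ u 0%N = x, u k = y & forall j, (j < k)%N -> d (f (u j)) (u j.+1) < e].

(** [N] is chosen before [x] and [y]; this uniformity yields exactness and passes to finite
    powers. *)
Definition uniformly_chain_mixing d f : Prop :=
  forall e : R, 0 < e -> exists2 N : nat, (0 < N)%N &
    forall k, (N <= k)%N -> forall x y, exists u, pseudo_orbit d f e k x y u.

Lemma pseudo_orbit_is_chain d f e k x y u :
  (0 < k)%N -> pseudo_orbit d f e k x y u -> is_chain d f e k x y.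
Proof.
move=> k0 [<- <- step]; split=> //.
exists [seq u j | j <- iota 1 k]; split.
- by rewrite size_map size_iota.
(* The start index 0 is written out so that the induction on [k] can generalise it. *)
- have : forall j, (0 <= j < 0 + k)%N -> d (f (u j)) (u j.+1) < e by [].
  elim: k 0%N {k0 step} => [//|k IH] i step /=.
  rewrite step ?leqnn ?addnS ?ltnS ?leq_addr//=.
  apply: IH => j /andP[ij jk]; apply: step.
  by rewrite (ltnW ij) addnS -addSn.
- by rewrite last_map (last_nth 0%N) size_iota -[_ :: _]/(iota 0 k.+1) nth_iota.
Qed.

Lemma uniformly_chain_mixing_chain_mixing d f :
  uniformly_chain_mixing d f -> chain_mixing d f.
Proof.
move=> mix e e0 x y; have [N N0 H] := mix e e0; exists N => // k Nk.
have [u] := H k Nk x y; apply: pseudo_orbit_is_chain; exact: leq_trans Nk.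
Qed.

(** With one [N] for all endpoints, a single point of [U] reaches every target in [N] steps. *)
Lemma uniformly_chain_mixing_chain_exact d f :
  uniformly_chain_mixing d f -> chain_exact d f.
Proof.
move=> mix e U e0 _ [y Uy]; have [N N0 H] := mix e e0; exists N => // x.
exists y => //; have [u] := H N (leqnn N) y x; exact: pseudo_orbit_is_chain.
Qed.

Lemma chain_mixing_chain_transitive d f :
  chain_mixing d f -> chain_transitive d f.
Proof.
by move=> mix x y e e0; have [N _ H] := mix e e0 x y; exists N; exact: H.
Qed.

End uniform_chain_mixing.

(** * Finite powers *)

Section powers.
Context {R : realType} {T : Type}.
Implicit Types (d : T -> T -> R) (f : T -> T).

(** A common length [k] serves all coordinates, so the coordinate orbits run in parallel and the
    maximum of their finitely many errors stays below [e]. *)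
Lemma uniformly_chain_mixing_power n d f :
  uniformly_chain_mixing d f ->
  uniformly_chain_mixing (@power_dist _ _ n d) (@power_map _ n f).
Proof.
move=> mix e e0; have [N N0 H] := mix e e0; exists N => // k Nk x y.
have [u uP] := choice (fun i => H k Nk (x i) (y i)).
exists (fun j i => u i j); split.
- by apply/funext => i; have [] := uP i.
- by apply/funext => i; have [] := uP i.
- move=> j jk; apply: bigmax_lt => // i _; have [_ _] := uP i; exact.
Qed.

Lemma uniformly_chain_mixing_weakly_mixing d f :
  uniformly_chain_mixing d f -> chain_weakly_mixing_all_orders d f.
Proof.
move=> mix n _; apply/chain_mixing_chain_transitive.
exact/uniformly_chain_mixing_chain_mixing/uniformly_chain_mixing_power.
Qed.

End powers.

(** The point sought is the last but one in a chain from [y] to itself. *)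
Lemma chain_transitive_predecessor {R : realType} {T : Type} (d : T -> T -> R)
    (f : T -> T) (e : R) (y : T) :
  chain_transitive d f -> 0 < e -> exists x, d (f x) y < e.
Proof.
move=> ctf e0; have [k [k0 [s [sk ps lasts]]]] := ctf y y e e0.
case: (lastP s) sk ps lasts => [|s' z]; first by move=> k_eq; rewrite -k_eq in k0.
by rewrite last_rcons rcons_path => _ /andP[_ ?] <-; exists (last y s').
Qed.

Lemma exists_convex_probability d (T : measurableType d) (R : realType)
    (mu nu : probability T R) (a b : R) :
  0 <= a -> 0 <= b -> a + b = 1 ->
  exists rho : probability T R,
    forall A, rho A = (a%:E * mu A + b%:E * nu A)%E.
Proof.
move=> a0 b0 ab.
pose rho : {measure set T -> \bar R} :=
  measure_add (mscale (NngNum a0) mu) (mscale (NngNum b0) nu).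
have rhoE A : (rho A = a%:E * mu A + b%:E * nu A)%E by exact: measure_addE.
have rho1 : rho setT = 1%E.
  by rewrite rhoE !probability_setT !mule1 -EFinD ab.
(* The total mass is 1, so normalizing keeps the values and supplies the probability structure; [mu]
   is the default for mass 0 or infinity. *)
exists (mnormalize rho mu) => A.
by rewrite /= /mnormalize rho1 onee_eq0 /= invr1 mule1 rhoE.
Qed.

(** * Fattenings and Prohorov estimates *)

Section borel_metric.
Context {R : realType} {X : pmetricType R}.
Implicit Types (A : set (borel X)) (e : R).

Lemma fatteningP A e (x : X) :
  fattening A e x <-> exists2 a, A a & mdist x a < e.
Proof.
split; first by move=> /ereal_inf_lt[_ [a Aa <-]]; rewrite lte_fin; exists a.
move=> [a Aa xa]; rewrite /fattening /=.
apply: (@le_lt_trans _ _ (mdist x a)%:E); last by rewrite lte_fin.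
by apply: ereal_inf_lbound; exists a.
Qed.

Lemma open_mdist_ball (a : X) e : open [set x | mdist a x < e].
Proof.
rewrite openE => x /= ax; apply/nbhs_ballP.
exists (e - mdist a x) => /=; first by rewrite subr_gt0.
move=> y; rewrite ballEmdist /= ltrBrDl; apply: le_lt_trans.
exact: metric_triangle.
Qed.

(** A fattening is a union of open balls, hence open. *)
Lemma measurable_fattening A e : measurable (fattening A e : set (borel X)).
Proof.
apply: sub_sigma_algebra.
rewrite (_ : fattening A e = \bigcup_(a in A) [set x | mdist a x < e]).
  by apply: bigcup_open => a _; exact: open_mdist_ball.
apply/seteqP; split=> x /=.
  by move=> /fatteningP[a Aa xa]; exists a => //=; rewrite metric_sym.
by move=> [a Aa /= ax]; apply/fatteningP; exists a => //; rewrite metric_sym.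
Qed.

Lemma sub_fattening A e : 0 < e -> A `<=` fattening A e.
Proof. by move=> e0 x Ax; apply/fatteningP; exists x => //; rewrite mdistxx. Qed.

Lemma prohorov_le (mu nu : borel_prob X) e : 0 < e ->
  (forall A, measurable A -> (mu A <= nu (fattening A e) + e%:E)%E /\
                             (nu A <= mu (fattening A e) + e%:E)%E) ->
  prohorov mu nu <= e.
Proof.
move=> e0 H; apply: ge_inf; last by [].
by exists 0 => r [/ltW].
Qed.

(** From [rho2] to [rho1], weight [t - s] is shifted from [sigma] to [alpha], which costs at most
    [e] additively; the rest of [sigma] is transported by [q], which the fattening absorbs. *)
Lemma prohorov_convex_le (alpha sigma rho1 rho2 : borel_prob X)
    (q : {mfun borel X >-> borel X}) (s t e : R) :
  0 <= s -> s <= t -> t <= 1 -> t - s <= e -> 0 < e ->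
  (forall x : X, mdist (q x) x < e) ->
  (forall A, rho1 A = (1 - s)%:E * alpha A + s%:E * sigma (q @^-1` A))%E ->
  (forall A, rho2 A = (1 - t)%:E * alpha A + t%:E * sigma A)%E ->
  prohorov rho1 rho2 <= e.
Proof.
move=> s0 st t1 tse e0 qe rho1E rho2E; apply: prohorov_le => // A mA.
have mq B : measurable B -> measurable (q @^-1` B).
  by move=> mB; rewrite -[_ @^-1` _]setTI; exact: measurable_funP.
have mAe := measurable_fattening A e.
have real (P : borel_prob X) B : measurable B ->
    exists2 r : R, P B = r%:E & 0 <= r <= 1.
  move=> mB; exists (fine (P B)); first by rewrite fineK ?fin_num_measure.
  rewrite -!lee_fin fineK ?fin_num_measure// measure_ge0.
  exact: probability_le1.
have mono (P : borel_prob X) B C : measurable B -> measurable C -> B `<=` C ->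
    (P B <= P C)%E.
  by move=> mB mC BC; apply: le_measure => //; rewrite inE.
have := mono alpha _ _ mA mAe (sub_fattening A e e0).
have := mono sigma _ _ (mq _ mA) mAe _.
have := mono sigma _ _ mA (mq _ mAe) _.
rewrite !rho1E !rho2E.
have [a -> /andP[a0 a1]] := real alpha _ mA.
have [a' -> /andP[a'0 a'1]] := real alpha _ mAe.
have [b -> /andP[b0 b1]] := real sigma _ (mq _ mA).
have [b' -> /andP[b'0 b'1]] := real sigma _ (mq _ mAe).
have [c -> /andP[c0 c1]] := real sigma _ mA.
have [c' -> /andP[c'0 c'1]] := real sigma _ mAe.
rewrite -!EFinM -!EFinD !lee_fin => cb bc aa.
(* As [q] moves points by less than [e], [A] lies in the preimage under [q] of its fattening, and
   the preimage of [A] lies in the fattening. *)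
have {}cb : c <= b'.
  by apply: cb => x Ax; apply/fatteningP; exists x.
have {}bc : b <= c'.
  by apply: bc => x Aqx; apply/fatteningP; exists (q x) => //; rewrite metric_sym.
(* The surplus weight [t - s] falls on [alpha] in the first inequality and on [sigma] in the second,
   each time multiplying a mass at most 1. *)
split; nra.
Qed.

End borel_metric.

(** * Uniform chain mixing of the induced map *)

Section induced_map_mixing.
Context {R : realType} {X : pmetricType R}.
Variables (compactX : compact [set: X]) (f : X -> X) (cf : continuous f).
Hypothesis ctf : chain_transitive (@mdist R X) f.

(** By chain transitivity the open [e]-balls around the points [f z] cover the space; compactness
    leaves finitely many [z], and picking the first suitable one from a list is a Borel choice. *)
Lemma measurable_approximate_section (e : R) : 0 < e ->
  exists p : {mfun borel X >-> borel X}, forall x : X, mdist (f (p x)) x < e.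
Proof.
move=> e0; move: compactX; rewrite compact_cover.
move=> /(_ X setT (fun z => [set x | mdist (f z) x < e])) [].
- by move=> z _; exact: open_mdist_ball.
- move=> y _; have [z zy] := chain_transitive_predecessor _ _ _ y ctf e0.
  by exists z.
move=> D _ cover.
have [p mp pP] : exists2 p : borel X -> borel X, measurable_fun setT p &
    forall x z, z \in (finmap.enum_fset D) -> mdist (f z) x < e ->
    mdist (f (p x)) x < e.
  (* The head [z] overrides the earlier map on the open set where it is suitable; for the empty list
     the claim is vacuous. *)
  elim: (finmap.enum_fset D) => [|z s [p mp IH]].
    by exists id.
  exists (fun x => if mdist (f z) x < e then z else p x).
    apply: measurable_fun_ifT => //; apply: (@measurable_fun_bool _ _ _ _ true).
    rewrite setTI; apply: sub_sigma_algebra.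
    rewrite (_ : _ @^-1` _ = [set x | mdist (f z) x < e]).
      exact: open_mdist_ball.
    by apply/seteqP; split.
  move=> x w; case: ifPn => [//|nzx]; rewrite inE => /orP[/eqP->|].
    by move=> zx; rewrite zx in nzx.
  exact: IH.
pose q : {mfun borel X >-> borel X} :=
  HB.pack p (isMeasurableFun.Build _ _ _ _ p mp).
exists q => x /=.
by have [z /= zD zx] := cover x I; exact: pP zx.
Qed.

Lemma induced_map_uniformly_chain_mixing :
  uniformly_chain_mixing (@prohorov R X) (induced_map cf).
Proof.
(* Halving [e] turns the non-strict Prohorov bound into the strict one required of a step. *)
move=> e e0; have e20 : 0 < e / 2 by rewrite divr_gt0.
have [p pP] := measurable_approximate_section (e / 2) e20.
pose N := (Num.truncn (e / 2)^-1).+1.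
exists N => // k Nk mu nu.
have k0 : (0 < k)%N by exact: leq_trans Nk.
have kR0 : 0 < k%:R :> R by rewrite ltr0n.
have ke : k%:R^-1 <= e / 2.
  rewrite invf_ple ?posrE//; apply/ltW/(lt_le_trans (truncnS_gt _)).
  by rewrite ler_nat.
pose t (j : nat) : R := j%:R / k%:R.
have t0 j : 0 <= t j by rewrite divr_ge0.
have t1 j : (j <= k)%N -> t j <= 1.
  by move=> jk; rewrite ler_pdivrMr// mul1r ler_nat.
pose alpha j := iter j (induced_map cf) mu.
pose sigma j : borel_prob X :=
  iter (k - j) (fun P : borel_prob X => distribution P p : borel_prob X) nu.
(* At [0] and [k] the given measures themselves are taken, since a combination with the same values
   need not be the same term. Beyond [k] the weight [1 - t j] is negative, and [mu] is a default. *)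
have /choice[u uP] : forall j, exists rho : borel_prob X, (j <= k)%N ->
    [/\ j = 0%N -> rho = mu, j = k -> rho = nu &
     forall A, rho A = ((1 - t j)%:E * alpha j A + (t j)%:E * sigma j A)%E].
  move=> j.
  have [->|j0] := eqVneq j 0%N.
    exists mu => _; split=> // [k_0|A]; first by rewrite -k_0 in k0.
    by rewrite /t mul0r subr0 mul1e mul0e adde0.
  have [->|jk] := eqVneq j k.
    exists nu => _; split=> // [k_0|A]; first by rewrite k_0 in k0.
    by rewrite /t /sigma divff ?gt_eqF// subrr subnn mul1e mul0e add0e.
  have [lejk|ltkj] := leqP j k; last by exists mu.
  have [rho rhoE] := @exists_convex_probability _ _ _ (alpha j) (sigma j)
    (1 - t j) (t j) ltac:(by rewrite subr_ge0 t1) (t0 j) (subrK _ _).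
  by exists rho => _; split=> // /eqP; rewrite ?(negbTE j0) ?(negbTE jk).
exists u; split.
- by have [-> //] := uP 0%N (leq0n k).
- by have [_ -> //] := uP k (leqnn k).
move=> j jk; apply: (@le_lt_trans _ _ (e / 2)); last by rewrite ltr_pdivrMr//; lra.
have [_ _ ujE] := uP j (ltnW jk); have [_ _ uSjE] := uP j.+1 jk.
have tS : t j.+1 = t j + k%:R^-1 by rewrite /t -natr1 mulrDl mul1r.
have sigmaS : sigma j = distribution (sigma j.+1) p.
  by rewrite /sigma -(subnSK jk).
(* The image of [u j] combines [alpha j.+1] and the image of [sigma j.+1] under [f \o p] with the
   weights at [j], so it differs from [u j.+1] only by this transport and by a weight change of
   [1/k]. *)
pose q : {mfun borel X >-> borel X} :=
  HB.pack (f \o p : borel X -> borel X) (isMeasurableFun.Build _ _ _ _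
    (f \o p : borel X -> borel X)
    (measurableT_comp (continuous_borel_measurable cf)
      (@measurable_funPT _ _ _ _ p))).
apply: (@prohorov_convex_le _ _ (alpha j.+1) (sigma j.+1) _ _ q (t j) (t j.+1)).
- exact: t0.
- by rewrite tS lerDl invr_ge0 ltW.
- exact: t1.
- by rewrite tS addrAC subrr add0r.
- exact: e20.
- exact: pP.
- by move=> A; rewrite induced_mapE ujE sigmaS.
- exact: uSjE.
Qed.

End induced_map_mixing.

Theorem corollary3p6 (R : realType) (X : pmetricType R)
    (compactX : compact [set: X]) (f : X -> X) (cf : continuous f)
    (ctf : chain_transitive (@mdist R X) f) :
  [/\ chain_mixing (@prohorov R X) (induced_map cf),
      chain_weakly_mixing_all_orders (@prohorov R X) (induced_map cf),
      chain_exact (@prohorov R X) (induced_map cf) &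
      chain_transitive (@prohorov R X) (induced_map cf)].
Proof.
have mix := induced_map_uniformly_chain_mixing compactX _ cf ctf.
have cmix := uniformly_chain_mixing_chain_mixing _ _ mix.
split=> //.
- exact: uniformly_chain_mixing_weakly_mixing.
- exact: uniformly_chain_mixing_chain_exact.
- exact: chain_mixing_chain_transitive.
Qed.
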